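(* Let $0<q<1$ and let $x\in\mathbb{C}\setminus\{0\}$. For every $a\in\mathbb{C}\setminus\{0\}$ with $a\neq\pm q^{k}$ for all $k\in\mathbb{Z}$, $$\frac{(-a,-q/a,q,q;q)_\infty}{(a,q/a,-q,-q;q)_\infty}\sum_{n=-\infty}^\infty\frac{q^{4n^2}x^{2n}}{1-a^2q^{2n}}=\sum_{j,k=-\infty}^\infty\frac{q^{(j+k)^2}(-1)^jx^{j+k}}{(1-aq^j)(1-aq^k)}.$$ Moreover, with $i=\sqrt{-1}$, $$\frac{(q,q;q)_\infty}{(-q,-q;q)_\infty}\sum_{n=-\infty}^\infty\frac{q^{4n^2}x^{2n}}{1+q^{2n+1}}=\sum_{j,k=-\infty}^\infty\frac{q^{(j+k)^2}(-1)^jx^{j+k}}{(1+iq^{j+1/2})(1+iq^{k+1/2})}.$$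
   Context: Notation: $(c;q)_\infty=\prod_{j\ge0}(1-cq^j)$ and $(c_1,\dots,c_r;q)_\infty=\prod_i(c_i;q)_\infty$. *)

(* Defs.v *)
From HB Require Import structures.
From mathcomp Require Import all_boot all_order all_algebra.
From mathcomp Require Import complex.
From mathcomp Require Import all_classical all_reals all_analysis.
From mathcomp.analysis.showcase Require summability.
Set Implicit Arguments.
Unset Strict Implicit.
Unset Printing Implicit Defensive.
Import Order.TTheory GRing.Theory Num.Theory.
Import numFieldNormedType.Exports.
Local Open Scope classical_set_scope.
Local Open Scope ring_scope.
Local Open Scope complex_scope.

(* The topology of the complex numbers R[i] is that of the normed module R[i]^o
   over itself. *)

Definition qpoch (R : realType) (q c : R[i]) : R[i] :=
  lim ((\prod_(0 <= j < n) (1 - c * q ^+ j) : R[i]^o) @[n --> \oo]).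

Definition qpochs (R : realType) (q : R[i]) (cs : seq R[i]) : R[i] :=
  \prod_(c <- cs) qpoch q c.

(* Bilateral series are unordered sums: the limit of the finite partial sums
   along the finite subsets of the index type, directed by inclusion.  For
   complex terms this convergence is equivalent to absolute convergence. *)

Definition usummable (R : realType) (I : choiceType) (f : I -> R[i]) : Prop :=
  cvg (summability.partial_sum (f : I -> R[i]^o) @ summability.totally).

Definition usum (R : realType) (I : choiceType) (f : I -> R[i]) : R[i] :=
  summability.sum (f : I -> R[i]^o).

(* Main.v *)
Require Import Defs.
From HB Require Import structures.
From mathcomp Require Import all_boot all_order all_algebra finmap.
From mathcomp Require Import complex.
From mathcomp Require Import all_classical all_reals all_analysis.
From mathcomp Require Import ring lra zify.
From mathcomp.analysis.showcase Require summability.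
Set Implicit Arguments.
Unset Strict Implicit.
Unset Printing Implicit Defensive.
Import Order.TTheory GRing.Theory Num.Theory.
Import numFieldNormedType.Exports.
Local Open Scope ring_scope.
Local Open Scope complex_scope.

Import ComplexField.Normc.

(** Write [pole a j] for [1 / (1 - a q^j)].  On the right side, group the terms by
    [m = j + k]: the coefficient of [q^(m^2) x^m] is the alternating sum over [j] of
    [pole a j * pole a (m - j)].  The reflection [j -> m - j] multiplies it by
    [(-1)^m], so it vanishes for odd [m] ([fiber_sum_odd]).  For [m = 2n], the
    product of two poles splits by partial fractions, since
    [a q^j * a q^(m-j) = a^2 q^m] does not involve [j]; hence [1 - a^2 q^(2n)] times
    the coefficient is the alternating sum of [pole a j + pole a (2n-j) - 1].  An
    even shift of the summation variable does not affect such a sum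
    ([usums_sign_shift]), so its value is a constant independent of [n]
    ([alternating_pole_sum], [fiber_sum_even]), and the coefficients match those
    of the single sum up to this constant.

    The constant is [2 H], where [H] is the alternating sum of
    [pole a j - pole (-1) j].  To recognize it as the theta quotient, expand the
    finite product of [(1 + a q^j) / (1 - a q^j)] over [|j| <= N] into partial
    fractions in [a] by Lagrange interpolation: the residues are explicit products
    ([theta_quotient_partial_fractions]), and letting [N] grow under a geometric
    majorant gives the identity ([theta_quotient_series]).  Subtracting
    [pole (-1) j] is harmless because the product vanishes at [a = -1], and it makes
    the series converge absolutely.

    The second identity is the case [a = - i q^(1/2)]: then [a^2 = - q], so
    [- q / a = a] and [q / a = - a], and the [a]-dependent part of the theta quotient
    is 1.

    The analytic work consists of a small theory of unordered complex sums
    (existence under a summable majorant, reindexing, Fubini, Tannery's theorem),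
    and of the bound [pole_bound], from which all majorants derive. *)

(** * The modulus on R[i] with values in R *)

Section Modulus.
Variable R : realType.
Implicit Types z w : R[i].

Lemma normc_ge0 z : 0 <= normc z.
Proof. by case: z => a b; rewrite /= sqrtr_ge0. Qed.

Lemma ler_normcD z w : normc (z + w) <= normc z + normc w.
Proof. exact: (@le_normcD R z w). Qed.

Lemma normc_opp z : normc (- z) = normc z.
Proof. exact: (@normcN R z). Qed.

Lemma ler_normcB z w : normc (z - w) <= normc z + normc w.
Proof. by rewrite -(normc_opp w) ler_normcD. Qed.

Lemma normc_distC z w : normc (z - w) = normc (w - z).
Proof. by rewrite -normc_opp opprB. Qed.

Lemma ler_dist_normc z w : normc z - normc w <= normc (z - w).
Proof. by rewrite lerBlDr -{1}(subrK w z) ler_normcD. Qed.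

Lemma normrE z : `|z| = (normc z)%:C.
Proof. by rewrite normc_def; case: z. Qed.

Lemma normc_real (r : R) : normc r%:C = `|r|.
Proof. by rewrite /= expr0n/= addr0 sqrtr_sqr. Qed.

Lemma normcX z n : normc (z ^+ n) = normc z ^+ n.
Proof. by elim: n => [|n IH]; rewrite ?expr0 ?normc1 // !exprS normcM IH. Qed.

Lemma normcXz z (k : int) : normc (z ^ k) = normc z ^ k.
Proof. by case: k => n; rewrite ?NegzE ?exprnN ?normcV -?exprnP normcX. Qed.

Lemma normc_eq0 z : (normc z == 0) = (z == 0).
Proof. by apply/eqP/eqP => [/eq0_normc|->] //; rewrite normc0. Qed.

Lemma normc_gt0 z : (0 < normc z) = (z != 0).
Proof. by rewrite lt0r normc_eq0 normc_ge0 andbT. Qed.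

Lemma ler_normc_sum (I : Type) (s : seq I) (f : I -> R[i]) :
  normc (\sum_(i <- s) f i) <= \sum_(i <- s) normc (f i).
Proof.
elim/big_rec2: _ => [|i y1 y2 _ le12]; first by rewrite normc0.
by rewrite (le_trans (ler_normcD _ _)) // lerD2l.
Qed.

Lemma normc_prod (I : Type) (s : seq I) (f : I -> R[i]) :
  normc (\prod_(i <- s) f i) = \prod_(i <- s) normc (f i).
Proof.
by elim/big_rec2: _ => [|i y1 y2 _ <-]; rewrite ?normc1 // normcM.
Qed.

Lemma normc_le_ReIm z : normc z <= `|complex.Re z| + `|complex.Im z|.
Proof.
case: z => a b; rewrite -(ler_pXn2r (n := 2)) ?nnegrE ?sqrtr_ge0 ?addr_ge0//.
rewrite sqr_sqrtr ?addr_ge0 ?sqr_ge0//= sqrrD !real_normK ?num_real//.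
have := mulr_ge0 (normr_ge0 a) (normr_ge0 b); set u := `|a| * `|b|; lra.
Qed.

Lemma Re_le_normc z : `|complex.Re z| <= normc z.
Proof.
case: z => a b; rewrite -(ler_pXn2r (n := 2)) ?nnegrE ?sqrtr_ge0//.
by rewrite sqr_sqrtr ?addr_ge0 ?sqr_ge0//= real_normK ?num_real// lerDl sqr_ge0.
Qed.

Lemma Im_le_normc z : `|complex.Im z| <= normc z.
Proof.
case: z => a b; rewrite -(ler_pXn2r (n := 2)) ?nnegrE ?sqrtr_ge0//.
by rewrite sqr_sqrtr ?addr_ge0 ?sqr_ge0//= real_normK ?num_real// lerDr sqr_ge0.
Qed.

End Modulus.

(** * Limits of complex sequences *)

Section Sequences.
Variable R : realType.
Implicit Types (u v : nat -> R[i]) (l m c : R[i]).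

(** The topology lives on the alias [R[i]^o]; naming the predicate lets terms
    stay in [R[i]]. *)
Definition ccvg u l : Prop :=
  ((u : nat -> R[i]^o) @ \oo --> (l : R[i]^o))%classic.

Lemma ccvgP u l :
  ccvg u l <-> forall e : R, 0 < e -> exists n0, forall n, (n0 <= n)%N -> normc (u n - l) < e.
Proof.
split=> [/(@cvgrPdist_lt _ R[i]^o) cvu e e0|cvu].
  have e0' : 0 < (e%:C : R[i]) by rewrite ltcR.
  have [n0 _ n0P] := cvu _ e0'; exists n0 => n n0n; have := n0P n n0n.
  by rewrite /= (normrE (_ : R[i])) ltcR normc_distC.
apply/(@cvgrPdist_lt _ R[i]^o) => -[e e'] e0.
have e'0 : e' = 0 by move: e0; rewrite ltcE /= => /andP[/eqP].
rewrite {e'}e'0 in e0 *.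
have /cvu[n0 n0P] : 0 < e by rewrite -ltcR.
exists n0 => // n n0n; rewrite /= (normrE (_ : R[i])) ltcR normc_distC.
exact: n0P.
Qed.

Lemma ccvg_lim u l : ccvg u l -> lim ((u : nat -> R[i]^o) @ \oo)%classic = l.
Proof. exact: (cvg_lim (@norm_hausdorff R[i] R[i]^o)). Qed.

Lemma ccvg_unique u l m : ccvg u l -> ccvg u m -> l = m.
Proof. exact: (cvg_unique (@norm_hausdorff R[i] R[i]^o)). Qed.

Lemma eq_ccvg u v l : u =1 v -> ccvg u l -> ccvg v l.
Proof. by move=> /funext->. Qed.

Lemma eventually_eq_ccvg u v l :
  (exists n0, forall n, (n0 <= n)%N -> u n = v n) -> ccvg u l -> ccvg v l.
Proof.
move=> [n0 uv] /ccvgP ul; apply/ccvgP => e /ul[n1 n1P].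
exists (maxn n0 n1) => n; rewrite geq_max => /andP[/uv <-]; exact: n1P.
Qed.

Lemma ccvg_comp u (k : nat -> nat) l :
  (forall M, exists n0, forall n, (n0 <= n)%N -> (M <= k n)%N) ->
  ccvg u l -> ccvg (fun n => u (k n)) l.
Proof.
move=> kinf /ccvgP ul; apply/ccvgP => e /ul[n1 n1P].
by have [n0 n0P] := kinf n1; exists n0 => n /n0P; exact: n1P.
Qed.

Lemma ccvg_cst c : ccvg (fun=> c) c.
Proof. exact: cvg_cst. Qed.

Lemma ccvgD u v l m : ccvg u l -> ccvg v m -> ccvg (fun n => u n + v n) (l + m).
Proof. exact: (@cvgD R[i] R[i]^o). Qed.

Lemma ccvgM u v l m : ccvg u l -> ccvg v m -> ccvg (fun n => u n * v n) (l * m).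
Proof. exact: (@cvgM R[i]). Qed.

Lemma ccvgB u v l m : ccvg u l -> ccvg v m -> ccvg (fun n => u n - v n) (l - m).
Proof. exact: (@cvgB R[i] R[i]^o). Qed.

Lemma ccvgV u l : l != 0 -> ccvg u l -> ccvg (fun n => (u n)^-1) l^-1.
Proof. exact: (@cvgV R[i]). Qed.

Lemma ccvg_sum (I : Type) (s : seq I) (u : I -> nat -> R[i]) (l : I -> R[i]) :
  (forall i, ccvg (u i) (l i)) ->
  ccvg (fun n => \sum_(i <- s) u i n) (\sum_(i <- s) l i).
Proof.
move=> ul; elim: s => [|i s IH].
  by rewrite big_nil; apply: (eq_ccvg _ (ccvg_cst (c := 0))) => n; rewrite big_nil.
rewrite big_cons; apply: (eq_ccvg _ (ccvgD (ul i) IH)) => n; by rewrite big_cons.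
Qed.

Lemma ccvg_bounded u l : ccvg u l -> exists2 K : R, 0 < K & forall n, normc (u n) <= K.
Proof.
move=> /ccvgP/(_ 1 ltr01)[n0 n0P].
exists (1 + normc l + \sum_(i < n0) normc (u i)).
  by rewrite ltr_wpDr ?sumr_ge0 ?ltr_wpDr ?normc_ge0// => i _; rewrite normc_ge0.
move=> n; have [nn0|n0n] := ltnP n n0.
  rewrite (bigD1 (Ordinal nn0)) //= [leRHS]addrCA lerDl.
  by rewrite !addr_ge0 ?normc_ge0// sumr_ge0 // => i _; rewrite normc_ge0.
rewrite (@le_trans _ _ (1 + normc l)) // ?lerDl ?sumr_ge0 // => [|i _]; last exact: normc_ge0.
by rewrite -lerBlDr (le_trans (ler_dist_normc _ _)) // ltW // n0P.
Qed.

End Sequences.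

(** * Unordered sums *)

Section UnorderedSums.
Variable R : realType.

#[local] Existing Instance summability.totally_filter.

Definition usums (I : choiceType) (f : I -> R[i]) (s : R[i]) : Prop :=
  (summability.partial_sum (f : I -> R[i]^o) @ summability.totally --> (s : R[i]^o))%classic.

Lemma usumsP (I : choiceType) (f : I -> R[i]) s :
  usums f s <-> forall e : R, 0 < e -> exists A : {fset I},
    forall B : {fset I}, (A `<=` B)%fset -> normc (\sum_(i <- B) f i - s) < e.
Proof.
have sumE (B : {fset I}) : summability.partial_sum (f : I -> R[i]^o) B = \sum_(i <- B) f i.
  by rewrite big_seq_fsetE.
split=> [/(@cvgrPdist_lt _ R[i]^o) cvf e e0|cvf].
  have e0' : 0 < (e%:C : R[i]) by rewrite ltcR.
  have [A _ AP] := cvf _ e0'.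
  exists A => B AB; have := AP B AB.
  by rewrite /= sumE (normrE (_ : R[i])) ltcR normc_distC.
apply/(@cvgrPdist_lt _ R[i]^o) => -[e e'] e0.
have e'0 : e' = 0 by move: e0; rewrite ltcE /= => /andP[/eqP].
rewrite {e'}e'0 in e0 *.
have /cvf[A AP] : 0 < e by rewrite -ltcR.
exists A => // B AB; rewrite /= sumE (normrE (_ : R[i])) ltcR normc_distC.
exact: AP.
Qed.

Lemma usums_unique (I : choiceType) (f : I -> R[i]) s t :
  usums f s -> usums f t -> s = t.
Proof. by move=> fs ft; apply: (cvg_unique (@norm_hausdorff R[i] R[i]^o) fs ft). Qed.

Lemma usums_summable (I : choiceType) (f : I -> R[i]) s :
  usums f s -> usummable f.
Proof. by move=> fs; apply/cvg_ex; exists s. Qed.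

Lemma usumE (I : choiceType) (f : I -> R[i]) s : usums f s -> usum f = s.
Proof. by move=> fs; apply: (cvg_lim (@norm_hausdorff R[i] R[i]^o) fs). Qed.

Lemma eq_usums (I : choiceType) (f g : I -> R[i]) s :
  f =1 g -> usums f s -> usums g s.
Proof. by move=> /funext->. Qed.

Lemma usumsD (I : choiceType) (f g : I -> R[i]) s t :
  usums f s -> usums g t -> usums (fun i => f i + g i) (s + t).
Proof.
move=> fs gt; apply: cvg_trans (cvgD fs gt); apply: near_eq_cvg.
by apply: nearW => A; exact/esym/big_split.
Qed.

Lemma usumsZ (I : choiceType) (f : I -> R[i]) s c :
  usums f s -> usums (fun i => c * f i) (c * s).
Proof.
move=> fs; apply: cvg_trans (@cvgZl_tmp R[i] R[i]^o _ _ _ c _ _ fs); apply: near_eq_cvg.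
by apply: nearW => A; exact: mulr_sumr.
Qed.

Lemma usumsB (I : choiceType) (f g : I -> R[i]) s t :
  usums f s -> usums g t -> usums (fun i => f i - g i) (s - t).
Proof.
move=> fs gt; have := usumsZ (c := -1) gt; rewrite mulN1r => /(usumsD fs).
by apply: eq_usums => i; rewrite mulN1r.
Qed.

(** Reindexing along an injection [h], as long as its image contains the support
    of [f].  With [h] bijective this moves summation variables; with
    [h n = 2 * n] it discards vanishing odd terms.  The map [k] inverts [h]
    on the support, and pulls a finite set of indices back to [I]. *)
Lemma usums_comp (I J : choiceType) (h : I -> J) (k : J -> I) (f : J -> R[i]) s :
  cancel h k -> (forall j, f j != 0 -> h (k j) = j) ->
  usums f s -> usums (fun i => f (h i)) s.
Proof.
move=> hK fK /usumsP fs; apply/usumsP => e /fs[A AP].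
exists (k @` A)%fset => B AB.
have -> : \sum_(i <- B) f (h i) = \sum_(j <- (h @` B)%fset) f j.
  by rewrite big_imfset //= => i i' _ _; apply: (can_inj hK).
rewrite (_ : \sum_(j <- _) _ = \sum_(j <- (A `|` h @` B)%fset) f j).
  by apply: AP; exact: fsubsetUl.
apply: big_fset_incl; first exact: fsubsetUr.
move=> j; rewrite in_fsetU => /orP[jA|->//] jhB; apply/eqP; apply: contraNT jhB.
move=> /fK <-; apply: in_imfset => /=; apply: (fsubsetP AB); exact: in_imfset.
Qed.

(** Fubini for unordered sums: finitely many inner sums are approximated
    simultaneously by one finite subset of [I * J], which may be chosen large
    enough for its sum to be near the double sum. *)
Lemma usums_fiber (I J : choiceType) (f : I * J -> R[i]) (S : I -> R[i]) s :
  usums f s -> (forall i, usums (fun j => f (i, j)) (S i)) -> usums S s.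
Proof.
move=> /usumsP fs fS; apply/usumsP => e e0.
have [A AP] := fs _ (divr_gt0 e0 (ltr0Sn _ 1)).
exists [fset p.1 | p in A]%fset => B AB.
pose d := e / 2 / (size B).+1%:R.
have d0 : 0 < d by rewrite !divr_gt0.
have /choice[C CP] : forall i, exists C : {fset J},
    (forall p, p \in A -> p.1 = i -> p.2 \in C) /\
    normc (\sum_(j <- C) f (i, j) - S i) < d.
  move=> i; have /usumsP/(_ _ d0)[C CP] := fS i.
  exists (C `|` [fset p.2 | p in A])%fset; split; last by apply: CP; apply: fsubsetUl.
  move=> p pA _; rewrite in_fsetU; apply/orP; right; exact: in_imfset.
pose D := [fset ((i, j) : I * J) | i in B, j in C i]%fset.
have sumD : \sum_(p <- D) f p = \sum_(i <- B) \sum_(j <- C i) f (i, j).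
  rewrite /D big_imfset2 /=; first by [].
  by move=> [? ?] [? ?] _ _ /= [-> ->].
have AD : (A `<=` D)%fset.
  apply/fsubsetP => -[i j] ijA; apply/imfset2P; exists i => /=.
    by apply: (fsubsetP AB); exact: (in_imfset _ _ (x := (i, j))).
  by exists j => //; exact: (CP i).1 _ ijA erefl.
have -> : \sum_(i <- B) S i - s =
   (\sum_(p <- D) f p - s) - \sum_(i <- B) (\sum_(j <- C i) f (i, j) - S i).
  by rewrite sumD sumrB; ring.
apply: le_lt_trans (ler_normcB _ _) _.
rewrite (splitr e); apply: ltr_leD; first exact: AP.
apply: le_trans (ler_normc_sum _ _) _.
apply: (@le_trans _ _ (\sum_(i <- B) d)).
  by apply: ler_sum => i _; apply/ltW; exact: (CP i).2.
rewrite big_const_seq count_predT iter_addr_0 -(mulr_natr d) /d.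
rewrite mulrAC ler_pdivrMr ?ltr0Sn// ler_pM2l ?divr_gt0// ler_nat.
exact: leqnSn.
Qed.

Lemma ler_sum_uniq (I : choiceType) (b : I -> R) (s t : seq I) :
  (forall i, 0 <= b i) -> uniq s -> uniq t -> {subset s <= t} ->
  \sum_(i <- s) b i <= \sum_(i <- t) b i.
Proof.
move=> b0; elim: s t => [|i s IH] t; first by rewrite big_nil sumr_ge0.
move=> /= /andP[is_ us] ut st; rewrite big_cons [leRHS](big_rem i) ?st ?mem_head //=.
rewrite lerD2l IH ?rem_uniq // => j js; rewrite mem_rem_uniq // !inE st ?inE ?js ?orbT //.
by rewrite andbT; apply: contraNneq is_ => <-.
Qed.

Lemma ler_sum_fsubset (I : choiceType) (b : I -> R) (A B : {fset I}) :
  (forall i, 0 <= b i) -> (A `<=` B)%fset ->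
  \sum_(i <- A) b i <= \sum_(i <- B) b i.
Proof. by move=> b0 /fsubsetP; apply: ler_sum_uniq. Qed.

(** For a nonnegative [b] this is summability, in the form that is
    easiest to transport along comparisons, injections and products. *)
Definition bounded_sums (I : choiceType) (b : I -> R) : Prop :=
  exists M : R, forall A : {fset I}, \sum_(i <- A) b i <= M.

Lemma bounded_sumsZ (I : choiceType) (b : I -> R) c : 0 <= c ->
  bounded_sums b -> bounded_sums (fun i => c * b i).
Proof.
move=> c0 [M bM]; exists (c * M) => A.
by rewrite -mulr_sumr ler_wpM2l.
Qed.

Lemma bounded_sums_comp (I J : choiceType) (h : I -> J) (b : J -> R) :
  injective h -> bounded_sums b -> bounded_sums (fun i => b (h i)).
Proof.
move=> hI [M bM]; exists M => A; apply: le_trans (bM (h @` A)%fset).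
by rewrite big_imfset //= => i j _ _; apply: hI.
Qed.

Lemma bounded_sums_prod (I J : choiceType) (a : I -> R) (b : J -> R) :
  (forall i, 0 <= a i) -> (forall j, 0 <= b j) ->
  bounded_sums a -> bounded_sums b ->
  bounded_sums (fun p : I * J => a p.1 * b p.2).
Proof.
move=> a0 b0 [M aM] [N bN]; exists (M * N) => A.
pose A1 := [fset p.1 | p in A]%fset; pose A2 := [fset p.2 | p in A]%fset.
pose D := [fset ((i, j) : I * J) | i in A1, j in A2]%fset.
have AD : (A `<=` D)%fset.
  apply/fsubsetP => p pA; apply/imfset2P; exists p.1; first exact: in_imfset.
  by exists p.2; [exact: in_imfset | case: p pA].
apply: (@le_trans _ _ (\sum_(p <- D) a p.1 * b p.2)).
  by apply: ler_sum_fsubset AD => p; rewrite mulr_ge0.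
rewrite /D big_imfset2 /=; last by move=> [? ?] [? ?] _ _ /= [-> ->].
under eq_bigr do rewrite -mulr_sumr.
rewrite -mulr_suml ler_pM ?sumr_ge0//.
Qed.

Lemma bounded_sums_sup (I : choiceType) (b : I -> R) :
  (forall i, 0 <= b i) -> bounded_sums b ->
  exists s, forall e, 0 < e -> exists A : {fset I}, forall B : {fset I},
    (A `<=` B)%fset -> `|\sum_(i <- B) b i - s| < e.
Proof.
move=> b0 [M bM]; pose E : set R := range (fun A : {fset I} => \sum_(i <- A) b i).
have hE : has_sup E.
  by split; [exists (\sum_(i <- fset0) b i), fset0 | exists M => _ [A _ <-]].
exists (sup E) => e e0; have [_ [A _ <-] Ae] := sup_adherent e0 hE.
exists A => B AB.
have leAB : \sum_(i <- A) b i <= \sum_(i <- B) b i.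
  exact: ler_sum_fsubset.
have leB : \sum_(i <- B) b i <= sup E by apply: (ub_le_sup hE.2); exists B.
by rewrite ler0_norm ?subr_le0// opprB ltrBlDr -ltrBlDl (lt_le_trans Ae).
Qed.

Lemma bounded_sums_tail (I : choiceType) (b : I -> R) :
  (forall i, 0 <= b i) -> bounded_sums b ->
  forall e, 0 < e -> exists A : {fset I}, forall B : {fset I},
    [disjoint A & B]%fset -> \sum_(i <- B) b i < e.
Proof.
move=> b0 bb e e0; have [s sP] := bounded_sums_sup b0 bb.
have [A AP] := sP _ (divr_gt0 e0 (ltr0Sn _ 1)); exists A => B dAB.
have := AP _ (fsubset_refl A); have := AP _ (fsubsetUl A B).
rewrite (big_fsetID _ (mem A)) /=.
rewrite (_ : [fset x | x in (A `|` B) & x \in A]%fset = A); last first.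
  by apply/fsetP => i; rewrite !inE /=; case: (i \in A); rewrite ?andbF.
rewrite (_ : [fset x | x in (A `|` B) & x \notin A]%fset = B); last first.
  apply/fsetP => i; rewrite !inE /=; case: (boolP (i \in A)); rewrite ?andbF ?andbT //= => iA.
  by apply/esym/negbTE; move/fdisjointP: dAB; apply.
by rewrite !ltr_norml; lra.
Qed.

(** Absolute convergence implies convergence.  Completeness is used through
    suprema: [normc (f i) + Re (f i)], [normc (f i) + Im (f i)] and
    [normc (f i)] are nonnegative with bounded sums, and [f] is recovered from
    their three sums by subtraction. *)
Lemma usums_ex (I : choiceType) (f : I -> R[i]) (b : I -> R) :
  (forall i, normc (f i) <= b i) -> bounded_sums b -> exists s, usums f s.
Proof.
move=> fb [M bM].
have bdd (g : I -> R) : (forall i, `|g i| <= normc (f i)) ->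
    bounded_sums (fun i => normc (f i) + g i).
  move=> gf; exists (M + M) => A; rewrite big_split /= lerD//.
    by apply: le_trans (bM A); apply: ler_sum.
  apply: le_trans (bM A); apply: ler_sum => i _.
  by rewrite (le_trans (ler_norm _))// (le_trans (gf _)).
have ge0 (g : I -> R) : (forall i, `|g i| <= normc (f i)) ->
    forall i, 0 <= normc (f i) + g i.
  by move=> gf i; have := gf i; rewrite ler_norml => /andP[]; lra.
have Reb i : `|complex.Re (f i)| <= normc (f i) by exact: Re_le_normc.
have Imb i : `|complex.Im (f i)| <= normc (f i) by exact: Im_le_normc.
have Zb i : `|0 : R| <= normc (f i) by rewrite normr0 normc_ge0.
have [s1 s1P] := bounded_sums_sup (ge0 _ Reb) (bdd _ Reb).
have [s2 s2P] := bounded_sums_sup (ge0 _ Imb) (bdd _ Imb).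
have [s3 s3P] := bounded_sums_sup (ge0 _ Zb) (bdd _ Zb).
exists ((s1 - s3) +i* (s2 - s3)); apply/usumsP => e e0.
have e40 : 0 < e / 4 by rewrite divr_gt0.
have [A1 A1P] := s1P _ e40; have [A2 A2P] := s2P _ e40; have [A3 A3P] := s3P _ e40.
exists (A1 `|` A2 `|` A3)%fset => B; rewrite !fsubUset => /andP[/andP[B1 B2] B3].
have := A1P _ B1; have := A2P _ B2; have := A3P _ B3; rewrite !big_split /=.
have -> : \sum_(i <- B) f i = (\sum_(i <- B) complex.Re (f i)) +i* (\sum_(i <- B) complex.Im (f i)).
  elim/big_rec3: _ => // i x y _ _ ->; by case: (f i).
rewrite [X in `|_ + X - s3|]big1 // addr0.
set v := \sum_(i <- B) complex.Re (f i); set w := \sum_(i <- B) complex.Im (f i).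
move=> h3 h2 h1; apply: le_lt_trans (normc_le_ReIm _) _ => /=.
move: h1 h2 h3; rewrite !ltr_norml => /andP[? ?] /andP[? ?] /andP[? ?].
have : `|v - (s1 - s3)| < e / 2 by rewrite ltr_norml; lra.
have : `|w - (s2 - s3)| < e / 2 by rewrite ltr_norml; lra.
lra.
Qed.

(** Tannery's theorem (dominated convergence for sums): the common majorant [b]
    makes everything outside a fixed finite set [A] uniformly small, and on [A]
    the limit is taken term by term. *)
Lemma usums_dominated (I : choiceType) (F : nat -> I -> R[i]) (D : nat -> {fset I})
    (f : I -> R[i]) (b : I -> R) s :
  bounded_sums b -> (forall n i, normc (F n i) <= b i) ->
  (forall n i, i \notin D n -> F n i = 0) ->
  (forall i, ccvg (fun n => F n i) (f i)) -> usums f s ->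
  ccvg (fun n => \sum_(i <- D n) F n i) s.
Proof.
move=> bb Fb FD Ff /usumsP fs.
have b0 i : 0 <= b i by apply: le_trans (Fb 0 i); exact: normc_ge0.
apply/ccvgP => e e0.
have e40 : 0 < e / 4 by rewrite divr_gt0.
have [A1 A1P] := fs _ e40; have [A2 A2P] := bounded_sums_tail b0 bb e40.
have [A A1A A2A] : exists2 A : {fset I}, (A1 `<=` A)%fset & (A2 `<=` A)%fset.
  by exists (A1 `|` A2)%fset; [exact: fsubsetUl | exact: fsubsetUr].
have [n0 n0P] := (ccvgP _ _).1 (ccvg_sum (s := enum_fset A) Ff) _ e40.
exists n0 => n /n0P h1.
have h2 : normc (\sum_(i <- A) f i - s) < e / 4 by apply: A1P.
have h3 : normc (\sum_(i <- D n) F n i - \sum_(i <- A) F n i) < e / 4.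
  have -> : \sum_(i <- A) F n i = \sum_(i <- [fset x | x in D n & x \in A]%fset) F n i.
    apply/esym/big_fset_incl.
      by apply/fsubsetP => i; rewrite !inE /= => /andP[].
    by move=> i iA; rewrite !inE /= iA andbT => /FD.
  rewrite (big_fsetID _ (mem A) (D n)) /= addrC addrK.
  apply: le_lt_trans (ler_normc_sum _ _) _.
  apply: le_lt_trans (ler_sum _ (fun i _ => Fb n i)) _.
  apply: A2P; apply/fdisjointP => i /(fsubsetP A2A) iA.
  by rewrite !inE /= iA andbF.
have -> : \sum_(i <- D n) F n i - s =
  (\sum_(i <- A) F n i - \sum_(i <- A) f i) + (\sum_(i <- A) f i - s) +
  (\sum_(i <- D n) F n i - \sum_(i <- A) F n i) by ring.
apply: le_lt_trans (ler_normcD _ _) _.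
have := ler_normcD (\sum_(i <- A) F n i - \sum_(i <- A) f i) (\sum_(i <- A) f i - s).
move: h1 h2 h3; lra.
Qed.


Lemma mem_iota_max (A : {fset nat}) :
  {subset A <= iota 0 (\max_(k <- A) k).+1}.
Proof.
move=> k kA; rewrite mem_iota /= add0n ltnS (big_rem k) //=.
exact: leq_maxl.
Qed.

Lemma bounded_sums_nat (b : nat -> R) M :
  (forall k, 0 <= b k) -> (forall n, \sum_(k < n) b k <= M) -> bounded_sums b.
Proof.
move=> b0 bM; exists M => A.
apply: le_trans (bM (\max_(k <- A) k).+1).
rewrite -(big_mkord xpredT) /index_iota subn0.
by apply: ler_sum_uniq => //; [exact: iota_uniq | exact: mem_iota_max].
Qed.

Lemma bounded_sums_int (b : int -> R) M N :
  (forall k, 0 <= b k) -> (forall n, \sum_(k < n) b (Posz k) <= M) ->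
  (forall n, \sum_(k < n) b (Negz k) <= N) -> bounded_sums b.
Proof.
move=> b0 bM bN; exists (M + N) => A.
pose n := (\max_(k <- A) `|k|)%N.+1.
apply: (@le_trans _ _ (\sum_(k <- map Posz (iota 0 n) ++ map Negz (iota 0 n)) b k)); last first.
  rewrite big_cat !big_map; apply: lerD.
    by apply: le_trans (bM n); rewrite -(big_mkord xpredT (b \o Posz)) /index_iota subn0.
  by apply: le_trans (bN n); rewrite -(big_mkord xpredT (b \o Negz)) /index_iota subn0.
apply: ler_sum_uniq => //.
  have uP : uniq (map Posz (iota 0 n)) by rewrite map_inj_uniq ?iota_uniq // => ? ? [].
  have uN : uniq (map Negz (iota 0 n)) by rewrite map_inj_uniq ?iota_uniq // => ? ? [].
  rewrite cat_uniq uP uN andbT andTb.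
  by apply/hasPn => _ /mapP[k _ ->]; apply/negP => /mapP[j _].
move=> k kA; rewrite mem_cat; have : (`|k| < n)%N.
  by rewrite ltnS (big_rem k) //= leq_maxl.
case: k {kA} => k kn; apply/orP; [left|right]; apply/map_f; rewrite mem_iota /= add0n //.
by apply: leq_trans kn; rewrite NegzE abszN.
Qed.

Lemma sum_geometric_le (q : R) n : 0 <= q -> q < 1 ->
  \sum_(k < n) q ^+ k <= (1 - q)^-1.
Proof.
move=> q0 q1; rewrite -[leRHS]mul1r ler_pdivlMr ?subr_gt0 // mulrC.
by rewrite -opprB mulNr -subrX1 opprB gerBl exprn_ge0.
Qed.

Lemma bounded_sums_geometric (q : R) : 0 <= q -> q < 1 ->
  bounded_sums (fun k : nat => q ^+ k).
Proof.
move=> q0 q1; apply: (@bounded_sums_nat _ (1 - q)^-1) => [k|n].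
  exact: exprn_ge0.
exact: sum_geometric_le.
Qed.

(** The majorant that every estimate over the integers is compared with. *)
Lemma bounded_sums_geometric_int (q : R) : 0 <= q -> q < 1 ->
  bounded_sums (fun k : int => q ^+ `|k|%N).
Proof.
move=> q0 q1; apply: (@bounded_sums_int _ (1 - q)^-1 (1 - q)^-1) => [k|n|n].
- exact: exprn_ge0.
- exact: sum_geometric_le.
- apply: le_trans (sum_geometric_le n q0 q1); apply: ler_sum => k _.
  by rewrite NegzE abszN absz_nat ler_wiXn2l // ltW.
Qed.

Lemma usums_nat (f : nat -> R[i]) s : usums f s -> ccvg (fun n => \sum_(k < n) f k) s.
Proof.
move=> /usumsP fs; apply/ccvgP => e /fs[A AP].
exists (\max_(k <- A) k).+1 => n An.
have -> : \sum_(k < n) f k = \sum_(k <- [fset k in iota 0 n]%fset) f k.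
  rewrite -(big_mkord xpredT) /index_iota subn0; apply: perm_big.
  apply: uniq_perm; [exact: iota_uniq | exact: fset_uniq | move=> k].
  by rewrite !inE.
apply: AP; apply/fsubsetP => k /mem_iota_max; rewrite mem_iota add0n andTb => kA.
by rewrite inE mem_iota add0n andTb (leq_trans kA).
Qed.

(** An infinite product whose factors differ from 1 by a summable sequence
    converges: the partial products [u n] are bounded by [expR M], so the
    increments [u n * b n] are summable. *)
Lemma ccvg_prod (b : nat -> R[i]) : bounded_sums (fun k => normc (b k)) ->
  exists l, ccvg (fun n => \prod_(k < n) (1 + b k)) l.
Proof.
move=> bb; have [M bM] := bb.
pose u n := \prod_(k < n) (1 + b k).
have uM n : normc (u n) <= expR M.
  rewrite /u normc_prod.
  apply: (@le_trans _ _ (\prod_(k < n) expR (normc (b k)))).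
    apply: ler_prod => k _; rewrite normc_ge0 /=.
    by rewrite (le_trans (ler_normcD _ _))// normc1 expR_ge1Dx.
  rewrite -expR_sum ler_expR; apply: le_trans (bM [fset k in iota 0 n]%fset).
  rewrite -(big_mkord xpredT (fun k => normc (b k))) /index_iota subn0.
  apply: ler_sum_uniq => [k|||k]; [exact: normc_ge0 |exact: iota_uniq | exact: fset_uniq |].
  by rewrite !inE.
have [s us] : exists s, usums (fun n => u n * b n) s.
  apply: (usums_ex (b := fun n => expR M * normc (b n))) => [n|].
    by rewrite normcM ler_wpM2r ?normc_ge0.
  by apply: bounded_sumsZ => //; exact: expR_ge0.
exists (1 + s).
apply: (eq_ccvg _ (ccvgD (ccvg_cst (c := 1)) (usums_nat us))) => n.
elim: n => [|n IH]; first by rewrite !big_ord0 addr0.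
by rewrite !big_ord_recr /= addrA IH /u mulrDr mulr1.
Qed.

End UnorderedSums.

(** * Convergence of q-Pochhammer products *)

Section qPochhammer.
Variables (R : realType) (q : R).
Hypotheses (q_gt0 : 0 < q) (q_lt1 : q < 1).
Local Notation Q := (q%:C).

Definition qpochn (c : R[i]) (n : nat) : R[i] := \prod_(k < n) (1 - c * Q ^+ k).

Lemma normcQX n : normc (Q ^+ n) = q ^+ n.
Proof. by rewrite normcX normc_real gtr0_norm. Qed.

Lemma ccvg_expQ : ccvg (fun n => Q ^+ n) 0.
Proof.
apply/ccvgP => e e0.
have : (q ^+ n @[n --> \oo] --> (0 : R))%classic.
  by apply: cvg_expr; rewrite gtr0_norm.
move=> /cvgrPdist_lt/(_ _ e0)[n0 _ n0P]; exists n0 => n /n0P /=.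
by rewrite sub0r normrN subr0 normcQX ger0_norm ?exprn_ge0// ltW.
Qed.

Lemma ccvg_sub_expQ c d : ccvg (fun n => d - c * Q ^+ n) d.
Proof.
have := ccvgB (ccvg_cst (c := d)) (ccvgM (ccvg_cst (c := c)) ccvg_expQ).
by rewrite mulr0 subr0.
Qed.

Lemma qpochn_cvg c : ccvg (qpochn c) (qpoch Q c).
Proof.
have [|l cl] := @ccvg_prod _ (fun k => - (c * Q ^+ k)).
  under [X in bounded_sums X]funext => k do rewrite normc_opp normcM normcQX.
  by apply/bounded_sumsZ/bounded_sums_geometric => //; rewrite ?normc_ge0 ?ltW.
suff -> : qpoch Q c = l by exact: cl.
apply: ccvg_lim.
by apply: (eq_ccvg _ cl) => n; rewrite big_mkord.
Qed.

(** The product of the inverse factors, [1 + c q^k / (1 - c q^k)], converges by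
    the same criterion, and the two limits multiply to 1. *)
Lemma qpoch_neq0 c : (forall k, 1 - c * Q ^+ k != 0) -> qpoch Q c != 0.
Proof.
move=> c0; have /(ccvgV (oner_neq0 _))/ccvg_bounded[K K0 KP] := ccvg_sub_expQ c (d := 1).
have [|l cl] := @ccvg_prod _ (fun k => c / (1 - c * Q ^+ k) * Q ^+ k).
  have bb := bounded_sums_geometric (ltW q_gt0) q_lt1.
  have [M bM] := bounded_sumsZ (mulr_ge0 (normc_ge0 c) (ltW K0)) bb.
  exists M => A; apply: le_trans (bM A); apply: ler_sum => k _.
  rewrite !normcM normcQX ler_wpM2r ?exprn_ge0 ?(ltW q_gt0)//.
  by rewrite ler_wpM2l ?normc_ge0.
have /ccvg_unique/(_ (ccvg_cst (c := 1))) : ccvg (fun=> 1) (l * qpoch Q c).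
  have cl2 := ccvgM cl (@qpochn_cvg c).
  apply: (eq_ccvg _ cl2) => n.
  rewrite -big_split big1 //= => k _; field.
  by have := c0 k.
move=> h; apply/eqP => p0; move: h; rewrite p0 mulr0 => /esym/eqP.
by rewrite oner_eq0.
Qed.

End qPochhammer.

(** * Size of the terms *)

Section Bounds.
Variables (R : realType) (q : R).
Hypotheses (q_gt0 : 0 < q) (q_lt1 : q < 1).
Local Notation Q := (q%:C).

Let q_neq0 : q != 0. Proof. by rewrite gt_eqF. Qed.

Lemma Q_neq0 : Q != 0.
Proof. by rewrite -normc_eq0 normc_real gtr0_norm. Qed.

Definition pole_free (a : R[i]) : Prop := forall k : int, 1 - a * Q ^ k != 0.

Definition pole (a : R[i]) (j : int) : R[i] := (1 - a * Q ^ j)^-1.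

(** The terms decay geometrically towards -oo and stay bounded towards +oo.  Both
    facts come from convergent, hence bounded, sequences: [1 / (1 - a q^n)] tends
    to 1, and [q^-n / (1 - a q^-n) = 1 / (q^n - a)] tends to [- 1 / a]. *)
Lemma pole_bound a : a != 0 -> pole_free a -> exists2 K : R, 0 < K &
  forall j, normc (pole a j) <= K /\ normc (pole a j) <= K * q ^ (- j).
Proof.
move=> a0 reg_a.
have /(ccvgV (oner_neq0 _))/ccvg_bounded[K1 K10 K1P] := @ccvg_sub_expQ _ _ q_gt0 q_lt1 a 1.
have na0 : - a != 0 by rewrite oppr_eq0.
have /(ccvgV na0)/ccvg_bounded[K2 K20 K2P] :=
  @ccvg_sub_expQ _ _ q_gt0 q_lt1 (-1) (- a).
have q1 n : q ^+ n <= 1 by rewrite exprn_ile1 // ltW.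
have qV n : 1 <= (q ^+ n)^-1 by rewrite invf_ge1 ?exprn_gt0.
have posP n : normc (pole a (Posz n)) <= K1 by exact: K1P.
have negP n : normc (pole a (- Posz n)) <= K2 * q ^+ n.
  have -> : pole a (- Posz n) = Q ^+ n * (- a - -1 * Q ^+ n)^-1.
    rewrite /pole -exprnN; have := reg_a (- Posz n); rewrite -exprnN => h.
    have Qn : Q ^+ n != 0 by rewrite expf_neq0 // Q_neq0.
    have h' : Q ^+ n - a != 0.
      by have := mulf_neq0 Qn h; rewrite mulrBr mulr1 mulrCA mulfV // mulr1.
    have h'' : - a - -1 * Q ^+ n != 0 by rewrite mulN1r opprK addrC.
    by field; rewrite h'' Qn.
  rewrite normcM (normcQX q_gt0) mulrC ler_wpM2r ?exprn_ge0 ?(ltW q_gt0) //.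
exists (K1 + K2); first exact: addr_gt0.
have K1K : K1 <= K1 + K2 by rewrite lerDl ltW.
have K2K : K2 <= K1 + K2 by rewrite lerDr ltW.
move=> j; have [n [->|->]] : exists n : nat, j = Posz n \/ j = - Posz n.
  by case: j => n; [exists n; left | exists n.+1; right; rewrite NegzE].
- split; first exact: le_trans (posP n) K1K.
  rewrite -exprnN; apply: (le_trans (posP n)); apply: (le_trans K1K).
  by rewrite ler_peMr // ltW // addr_gt0.
- rewrite opprK -exprnP; split.
    apply: (le_trans (negP n)); apply: le_trans K2K.
    by rewrite ler_piMr // ltW.
  by apply: (le_trans (negP n)); rewrite ler_wpM2r ?exprn_ge0 ?(ltW q_gt0) //.
Qed.

(** Of the two factors, the one with the negative exponent supplies the decay;
    for [j >= 0] that factor is [pole b (m - j)], at the price of [q^-|m|]. *)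
Lemma pole_mul_reflect_bound a b : a != 0 -> b != 0 -> pole_free a -> pole_free b ->
  exists2 K : R, 0 < K & forall m j,
    normc (pole a j * pole b (m - j)) <= K * (q ^+ `|m|)^-1 * q ^+ `|j|.
Proof.
move=> a0 b0 ra rb; have [K K0 KP] := pole_bound a0 ra.
have [L L0 LP] := pole_bound b0 rb.
exists (K * L); first exact: mulr_gt0.
have qm (m : int) : q ^ (- m) <= (q ^+ `|m|)^-1.
  case: m => n; first by rewrite -exprnN.
  rewrite NegzE opprK abszN absz_nat -exprnP (@le_trans _ _ 1) //.
    by rewrite exprn_ile1 // ltW.
  by rewrite invf_ge1 ?exprn_gt0 // exprn_ile1 // ltW.
have qm1 (m : int) : 1 <= (q ^+ `|m|)^-1.
  by rewrite invf_ge1 ?exprn_gt0 // exprn_ile1 // ltW.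
move=> m j; rewrite normcM; case: j => n.
  have := (KP (Posz n)).1; have := (LP (m - Posz n)).2.
  rewrite opprB expfzDr // -exprnP => h1 h2 /=.
  rewrite -[leRHS]mulrA -[leRHS]mulrA; apply: ler_pM => //; rewrite ?normc_ge0 //.
  apply: (le_trans h1); rewrite ler_wpM2l ?(ltW L0) // mulrC.
  by rewrite ler_wpM2r ?exprn_ge0 ?(ltW q_gt0) //.
have := (KP (Negz n)).2; have := (LP (m - Negz n)).1.
rewrite NegzE opprK abszN absz_nat -exprnP => h1 h2.
rewrite [leRHS](_ : _ = (K * q ^+ n.+1) * (L * (q ^+ `|m|)^-1)); last by ring.
apply: ler_pM; rewrite ?normc_ge0 //; apply: (le_trans h1).
by rewrite ler_peMr ?(ltW L0).
Qed.

(** For [j < 0] the two poles contribute [q^-2j], which beats the growing factor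
    [q^j]. *)
Lemma expQ_pole_mul_bound a b : a != 0 -> b != 0 -> pole_free a -> pole_free b ->
  exists2 K : R, 0 < K & forall j,
    normc (Q ^ j * pole a j * pole b j) <= K * q ^+ `|j|.
Proof.
move=> a0 b0 ra rb; have [K K0 KP] := pole_bound a0 ra.
have [L L0 LP] := pole_bound b0 rb.
exists (K * L); first exact: mulr_gt0.
move=> j; rewrite !normcM normcXz normc_real gtr0_norm //; case: j => n.
  rewrite -exprnP /= [leRHS]mulrC -mulrA ler_wpM2l ?exprn_ge0 ?(ltW q_gt0) //.
  by apply: ler_pM; rewrite ?normc_ge0 //; [exact: (KP _).1 | exact: (LP _).1].
have := (KP (Negz n)).2; have := (LP (Negz n)).2.
rewrite NegzE opprK abszN absz_nat -exprnP -exprnN => h1 h2.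
have q0 : q ^+ n.+1 != 0 by rewrite expf_neq0.
rewrite [leRHS](_ : _ = (q ^+ n.+1)^-1 * (K * q ^+ n.+1) * (L * q ^+ n.+1)); last by field.
by rewrite !ler_pM ?mulr_ge0 ?invr_ge0 ?exprn_ge0 ?normc_ge0 // ltW.
Qed.

(** The product is [(q^n Y)^n], whose base is at most 1 from some [N] on and at
    most [Y] before. *)
Lemma gauss_growth (Y : R) : 1 <= Y ->
  exists c : R, forall n : nat, q ^+ (n * n) * Y ^+ n <= c.
Proof.
move=> Y1; have Y0 : 0 < Y by exact: lt_le_trans Y1.
have [N NP] : exists N, q ^+ N * Y <= 1.
  have : (q ^+ n @[n --> \oo] --> (0 : R))%classic by apply: cvg_expr; rewrite gtr0_norm.
  have Yi0 : 0 < Y^-1 by rewrite invr_gt0.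
  move=> /cvgrPdist_lt/(_ _ Yi0)[N _ /(_ N (leqnn _))] /=.
  rewrite sub0r normrN ger0_norm ?exprn_ge0 ?(ltW q_gt0) // => h.
  by exists N; rewrite -ler_pdivlMr // mul1r ltW.
exists (Y ^+ N) => n; rewrite exprM -exprMn.
have [nN|Nn] := leqP n N.
  rewrite (@le_trans _ _ (Y ^+ n)) ?ler_weXn2l //.
  rewrite lerXn2r ?nnegrE ?mulr_ge0 ?exprn_ge0 ?(ltW q_gt0) ?(ltW Y0) //.
  by rewrite ler_piMl ?(ltW Y0) // exprn_ile1 // ltW.
rewrite (@le_trans _ _ 1) ?exprn_ege1 // exprn_ile1 ?mulr_ge0 ?exprn_ge0 ?(ltW q_gt0) ?(ltW Y0) //.
apply: le_trans NP; rewrite ler_wpM2r ?(ltW Y0) // ler_wiXn2l ?(ltW q_gt0) ?(ltW q_lt1) //.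
exact: ltnW.
Qed.

Lemma bounded_sums_theta (X : R) : 0 < X ->
  bounded_sums (fun m : int => q ^ (m ^+ 2) * X ^ m * (q ^+ `|m|)^-1).
Proof.
move=> X0; pose Y := 1 + X + X^-1; have Xi0 : 0 < X^-1 by rewrite invr_gt0.
have Y1 : 1 <= Y by rewrite /Y; lra.
have q2 : 1 <= (q ^+ 2)^-1 by rewrite invf_ge1 ?exprn_gt0 // exprn_ile1 // ltW.
(* The factor q^-2 absorbs both the loss q^-|m| and the q^|m| to be gained. *)
have [c cP] : exists c : R, forall n, q ^+ (n * n) * (Y * (q ^+ 2)^-1) ^+ n <= c.
  by apply: gauss_growth; apply: mulr_ege1.
have c0 : 0 <= c by apply: le_trans (cP 0%N); rewrite mul0n !expr0 mulr1.
have [M bM] := bounded_sumsZ c0 (bounded_sums_geometric_int (ltW q_gt0) q_lt1).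
exists M => A; apply: le_trans (bM A); apply: ler_sum => m _.
have Xm : X ^ m <= Y ^+ `|m|.
  case: m => n /=; rewrite ?NegzE -?exprnN -?exprVn -?exprnP lerXn2r ?nnegrE //; rewrite /Y; lra.
have -> : m ^+ 2 = Posz (`|m| * `|m|)%N by case: m {Xm} => n; rewrite /=; lia.
move: `|m|%N Xm => n Xm; rewrite -exprnP.
have q0 : q ^+ n != 0 by rewrite expf_neq0.
have /(ler_wpM2r (exprn_ge0 n (ltW q_gt0))) := cP n; apply: le_trans.
rewrite [leRHS](_ : _ = q ^+ (n * n) * Y ^+ n * (q ^+ n)^-1); last first.
  have q2n : (q ^+ 2) ^+ n = q ^+ n * q ^+ n by rewrite -exprM mul2n -addnn exprD.
  by rewrite exprMn exprVn q2n; field.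
by rewrite ler_wpM2r ?invr_ge0 ?exprn_ge0 ?(ltW q_gt0) // ler_wpM2l ?exprn_ge0 ?(ltW q_gt0).
Qed.

End Bounds.

(** * Partial fractions of a finite theta quotient *)

Lemma size_prod_linear_neq (F : fieldType) (n : nat) (i : 'I_n) (c : 'I_n -> F) :
  (size (\prod_(k | k != i) (1 + c k *: 'X))%R <= n)%N.
Proof.
apply: (leq_trans (size_prod_leq _ _)).
have cardi : #|[pred k : 'I_n | k != i]| = n.-1.
  by rewrite (eq_card (B := predC1 i)) // cardC1 card_ord.
rewrite (eq_card (B := [pred k : 'I_n | k != i])) // cardi.
have : (\sum_(k | k != i) size (1 + c k *: 'X)%R <= \sum_(k < n | k != i) 2)%N.
  apply: leq_sum => k _; apply: (leq_trans (size_polyD _ _)).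
  rewrite size_poly1 geq_max /= (leq_trans (size_scale_leq _ _)) //.
  by rewrite size_polyX.
have n0 : (0 < n)%N by case: n i {c cardi} => [[]|].
rewrite sum_nat_const cardi; move: (\sum_(k | _) _)%N => S; lia.
Qed.

(** Lagrange interpolation of [p] at the points [1 / y i], divided by the product
    of all the factors [1 - a * y i]. *)
Lemma lagrange_partial_fractions (F : fieldType) (n : nat) (y : 'I_n -> F) (p : {poly F}) (a : F) :
  (size p <= n)%N -> injective y -> (forall i, y i != 0) ->
  (forall i, 1 - a * y i != 0) ->
  p.[a] / \prod_i (1 - a * y i) =
  \sum_i p.[(y i)^-1] / ((1 - a * y i) * \prod_(k | k != i) (1 - y k / y i)).
Proof.
move=> szp yI y0 ay0.
pose L i : {poly F} := \prod_(k | k != i) (1 + - y k *: 'X).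
pose w i := \prod_(k | k != i) (1 - y k / y i).
have w0 i : w i != 0.
  apply/prodf_neq0 => k ki; rewrite subr_eq0; apply: contra ki => /eqP h.
  by apply/eqP/yI; rewrite -[LHS](divfK (y0 i)) -h mul1r.
have LE i b : (L i).[b] = \prod_(k | k != i) (1 - b * y k).
  by rewrite horner_prod; apply: eq_bigr => k _; rewrite !hornerE mulNr mulrC.
have szL i : (size (L i) <= n)%N by exact: size_prod_linear_neq.
have pE : p = \sum_i (p.[(y i)^-1] / w i) *: L i.
  apply/eqP; rewrite -subr_eq0; apply/eqP.
  apply: (@roots_geq_poly_eq0 _ _ [seq (y i)^-1 | i <- enum 'I_n]).
  - apply/allP => _ /mapP[i _ ->]; rewrite rootE !hornerE horner_sum.
    rewrite (bigD1 i) //= big1 => [|k ki].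
      rewrite addr0 hornerZ LE (_ : \prod_(k | _) _ = w i).
        by rewrite divfK // subrr.
      by apply: eq_bigr => k _; rewrite mulrC.
    rewrite hornerZ LE (bigD1 i) ?(eq_sym i) //=.
    by rewrite mulVf // subrr mul0r mulr0.
  - rewrite map_inj_uniq ?enum_uniq // => i j /invr_inj; exact: yI.
  - rewrite size_map size_enum_ord.
    apply: (leq_trans (size_polyD _ _)); rewrite size_polyN geq_max szp /=.
    apply: (leq_trans (size_sum _ _ _)); apply/bigmax_leqP => i _.
    exact: (leq_trans (size_scale_leq _ _)).
rewrite {1}pE horner_sum mulr_suml; apply: eq_bigr => i _.
rewrite hornerZ LE [X in _ / X = _](bigD1 i) //= -/(w i).
have d0 : \prod_(k | k != i) (1 - a * y k) != 0 by apply/prodf_neq0.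
by field; rewrite d0 ay0 w0.
Qed.

Lemma prod_centered (F : comRingType) (s : int -> F) (M N : nat) :
  \prod_(k < M + N) s (k%:Z - M%:Z) =
  (\prod_(l < M) s (- l.+1%:Z)) * \prod_(l < N) s l%:Z.
Proof.
rewrite big_split_ord /=; congr (_ * _); last first.
  by apply: eq_bigr => l _; congr s; rewrite PoszD; ring.
rewrite (reindex_inj rev_ord_inj) /=; apply: eq_bigr => l _; congr s.
by rewrite -subzn ?ltn_ord //; ring.
Qed.


Section ThetaQuotient.
Variables (R : realType) (q : R).
Hypotheses (q_gt0 : 0 < q) (q_lt1 : q < 1).
Local Notation Q := (q%:C).
Local Notation pole_free := (pole_free q).
Local Notation pole := (pole q).
Local Notation E := (qpochn q).

Let Q0 : Q != 0. Proof. exact: Q_neq0. Qed.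

Lemma expQ_real (j : int) : Q ^ j = (q ^ j)%:C.
Proof. by rewrite (rmorphXz (real_complex R)) // unitfE gt_eqF. Qed.

Lemma pole_freeN1 : pole_free (-1).
Proof.
move=> j; rewrite mulN1r opprK expQ_real -(rmorph1 (real_complex R)) -rmorphD fmorph_eq0.
by rewrite gt_eqF // addr_gt0 // exprz_gt0.
Qed.

Lemma expQ_neq1 (j : int) : j != 0 -> Q ^ j != 1.
Proof.
move=> j0; rewrite expQ_real -(rmorph1 (real_complex R)) (inj_eq (@complexI R)).
case: j j0 => n n0; rewrite ?NegzE -?exprnN ?invr_eq1 -?exprnP; rewrite lt_eqF //.
  by rewrite exprn_ilt1 // ?ltW // -lt0n.
by rewrite exprn_ilt1 // ltW.
Qed.

(** The product of [(1 + q^k) / (1 - q^k)] for [1 <= k <= n]. *)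
Definition qratio (n : nat) : R[i] := E (- Q) n / E Q n.

Let mQ (k : nat) : 1 - Q * Q ^+ k != 0.
Proof. by rewrite -exprS subr_eq0 eq_sym; exact: (expQ_neq1 (j := Posz k.+1)). Qed.

(** These are, up to a factor 2, the residues of the finite theta quotient.  The
    [m] factors with negative exponent change sign when the exponent does, whence
    [(-1) ^+ m]. *)
Lemma prod_qratio (m n : nat) :
  \prod_(k < m + n.+1 | k != m :> nat) ((1 + Q ^ (k%:Z - m%:Z)) / (1 - Q ^ (k%:Z - m%:Z))) =
  (-1) ^+ m * qratio m * qratio n.
Proof.
(* Setting the factor at 0 to 1 turns the punctured product into a full one. *)
pose r (j : int) := if j == 0 then 1 else (1 + Q ^ j) / (1 - Q ^ j).
have -> : \prod_(k < m + n.+1 | k != m :> nat) ((1 + Q ^ (k%:Z - m%:Z)) / (1 - Q ^ (k%:Z - m%:Z))) =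
    \prod_(k < m + n.+1) r (k%:Z - m%:Z).
  rewrite big_mkcond; apply: eq_bigr => k _; rewrite /r subr_eq0 eqz_nat.
  by case: eqP.
rewrite prod_centered big_ord_recl /r eqxx mul1r /qratio /qpochn; congr (_ * _); last first.
  by rewrite -prodf_div; apply: eq_bigr => l _; rewrite mulNr opprK -exprS.
rewrite -prodf_div -[m in (-1) ^+ m]card_ord -prodr_const -big_split /=.
apply: eq_bigr => l _; rewrite -exprnN exprS /=.
have := mQ l; have Ql : Q ^+ l != 0 by rewrite expf_neq0.
by move=> h; field; rewrite h Q0 Ql /= -oppr_eq0 opprB h.
Qed.

(** The left side is, up to the sign [(-1)^N], the product of
    [(1 + a q^j) / (1 - a q^j)] over [|j| <= N].  Its numerator has as many factors
    as its denominator, so the factor [1 + a] is set aside before interpolating;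
    multiplied back, it combines with the residue at [q^-j] into the difference
    [pole a j - pole (-1) j].  Each term thus decays with [j], which the limit
    [N -> oo] needs. *)
Lemma theta_quotient_partial_fractions a (N : nat) : a != 0 -> pole_free a ->
  E (- a) N.+1 * E (- Q / a) N / (E a N.+1 * E (Q / a) N) =
  \sum_(i < N + N.+1) (-1) ^ (i%:Z - N%:Z) * (qratio i * qratio (N + N - i)) *
     (2 * (pole a (i%:Z - N%:Z) - pole (-1) (i%:Z - N%:Z))).
Proof.
move=> a0 ra.
pose y (k : 'I_(N + N.+1)) := Q ^ (k%:Z - N%:Z).
have lN : (N < N + N.+1)%N by lia.
pose o := Ordinal lN.
have y0 i : y i != 0 by rewrite expfz_neq0.
have yI : injective y.
  move=> i j yij; apply/val_inj/eqP; rewrite -eqz_nat -subr_eq0.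
  apply: contraT => /expQ_neq1/eqP[]; move: yij; rewrite /y => yij.
  have -> : i%:Z - j%:Z = (i%:Z - N%:Z) - (j%:Z - N%:Z) by ring.
  by rewrite expfzDr // yij -expfzDr // subrr.
have yo : y o = 1 by rewrite /y /= subrr.
pose p : {poly R[i]} := \prod_(k | k != o) (1 + y k *: 'X).
have pE b : p.[b] = \prod_(k | k != o) (1 + b * y k).
  by rewrite horner_prod; apply: eq_bigr => k _; rewrite !hornerE mulrC.
have szp : (size p <= N + N.+1)%N by exact: size_prod_linear_neq.
have /(_ a (fun i => ra _)) := lagrange_partial_fractions szp yI y0.
rewrite pE => /(congr1 ( *%R (1 + a))); rewrite mulrA.
rewrite [X in X / _ = _](_ : _ = \prod_k (1 + a * y k)); last first.
  by rewrite [RHS](bigD1 o) //= yo mulr1.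
rewrite -prodf_div.
rewrite (prod_centered (fun j => (1 + a * Q ^ j) / (1 - a * Q ^ j))).
move=> /(congr1 ( *%R ((-1) ^+ N))) H.
transitivity ((-1) ^+ N *
    ((\prod_(l < N) ((1 + a * Q ^ (- l.+1%:Z)) / (1 - a * Q ^ (- l.+1%:Z)))) *
      \prod_(l < N.+1) ((1 + a * Q ^ l) / (1 - a * Q ^ l)))).
  rewrite -[N in (-1) ^+ N]card_ord -prodr_const mulrA -big_split /=.
  rewrite [LHS](_ : _ = (E (- Q / a) N / E (Q / a) N) * (E (- a) N.+1 / E a N.+1)); last first.
    by rewrite invfM; ring.
  rewrite /qpochn -!prodf_div; congr (_ * _); apply: eq_bigr => l _; last by rewrite mulNr opprK.
  rewrite -exprnN; have := ra (- l.+1%:Z); rewrite -exprnN exprS => h.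
  have Ql : Q ^+ l != 0 by rewrite expf_neq0.
  have h1 : Q * Q ^+ l - a != 0.
    by have := mulf_neq0 (mulf_neq0 Q0 Ql) h; rewrite mulrBr mulr1 mulrCA mulfV ?mulr1 ?mulf_neq0.
  have h2 : a - Q * Q ^+ l != 0 by rewrite -oppr_eq0 opprB.
  by field; apply/and5P.
rewrite H mulr_sumr mulr_sumr; apply: eq_bigr => i _.
rewrite pE.
have yV k : y k / y i = Q ^ (k%:Z - i%:Z).
  by rewrite /y invr_expz -expfzDr //; congr (_ ^ _); ring.
have y1 : 1 + (y i)^-1 != 0.
  by have := pole_freeN1 (- (i%:Z - N%:Z)); rewrite mulN1r opprK -invr_expz.
have swap : (1 + (y i)^-1) * \prod_(k | k != o) (1 + (y i)^-1 * y k) =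
            2 * \prod_(k | k != i) (1 + y k / y i).
  transitivity (\prod_k (1 + y k / y i)).
    rewrite [RHS](bigD1 o) //= yo mul1r; congr (_ * _).
    by apply: eq_bigr => k _; rewrite mulrC.
  by rewrite (bigD1 i) //= divff.
have Pi : \prod_(k | k != i) (1 + y k / y i) / \prod_(k | k != i) (1 - y k / y i) =
    (-1) ^+ i * qratio i * qratio (N + N - i).
  rewrite -prod_qratio -prodf_div.
  have -> : (i + (N + N - i).+1 = N + N.+1)%N by have := ltn_ord i; lia.
  by apply: eq_bigr => k _; rewrite yV.
have D0 : \prod_(k | k != i) (1 - y k / y i) != 0.
  apply/prodf_neq0 => k ki; rewrite yV subr_eq0 eq_sym expQ_neq1 //.
  by rewrite subr_eq0 eqz_nat.
have sgn : (-1) ^ (i%:Z - N%:Z) = (-1) ^+ i * (-1) ^+ N :> R[i].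
  by rewrite expfzDr ?oppr_eq0 ?oner_eq0 // -exprnN -exprVn invrN1.
have poleE b : pole b (i%:Z - N%:Z) = (1 - b * y i)^-1 by [].
rewrite sgn !poleE.
have yi1 : 1 + y i != 0.
  by have := mulf_neq0 (y0 i) y1; rewrite mulrDr mulr1 divff // addrC.
move: (y i) (y0 i) (ra _ : 1 - a * y i != 0) y1 yi1 swap Pi D0 => z z0 az y1 yi1.
set A := \prod_(k | k != o) _; set B := \prod_(k | k != i) (1 + _).
set D := \prod_(k | k != i) (1 - _) => swap Pi D0.
rewrite -[RHS]mulrA [(-1) ^+ i * _]mulrC -[RHS]mulrA; congr (_ * _).
rewrite [RHS]mulrA [(-1) ^+ i * _]mulrA -Pi.
have -> : A = 2 * B / (1 + z^-1) by rewrite -swap mulrC mulKf.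
by field; rewrite mulN1r opprK yi1 az D0 z0.
Qed.

End ThetaQuotient.

(** * The infinite theta quotient as a bilateral series *)

Section ThetaQuotientLimit.
Variables (R : realType) (q : R).
Hypotheses (q_gt0 : 0 < q) (q_lt1 : q < 1).
Local Notation Q := (q%:C).
Local Notation pole_free := (pole_free q).
Local Notation pole := (pole q).
Local Notation E := (qpochn q).

Lemma oneN_neq0 : (-1 : R[i]) != 0.
Proof. by rewrite oppr_eq0 oner_eq0. Qed.

Lemma normc_sign (j : int) : normc ((-1 : R[i]) ^ j) = 1.
Proof. by rewrite normcXz normc_opp normc1 exp1rz. Qed.

Lemma pole_free_nat a : pole_free a -> forall k : nat, 1 - a * Q ^+ k != 0.
Proof. by move=> ra k; exact: (ra k%:Z). Qed.

Lemma pole_free_Qdiv a : a != 0 -> pole_free a -> pole_free (Q / a).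
Proof.
move=> a0 ra j; have Qj : Q ^ (1 + j) != 0 by rewrite expfz_neq0 // Q_neq0.
have := mulf_neq0 (mulf_neq0 (invr_neq0 a0) Qj) (ra (- (1 + j))).
rewrite -invr_expz -oppr_eq0 => h; apply: contra_neq h => h.
rewrite -h expfzDr ?Q_neq0 // expr1z; field.
by rewrite a0 Q_neq0 // expfz_neq0 // Q_neq0.
Qed.

Lemma qpoch_Q_neq0 : qpoch Q Q != 0.
Proof.
apply: qpoch_neq0 => // k.
by rewrite -exprS subr_eq0 eq_sym; exact: (expQ_neq1 q_gt0 q_lt1 (j := Posz k.+1)).
Qed.

Lemma qpoch_NQ_neq0 : qpoch Q (- Q) != 0.
Proof.
apply: qpoch_neq0 => // k.
by have := pole_freeN1 q_gt0 (Posz k.+1); rewrite mulN1r mulNr -exprS.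
Qed.

Definition qratio_lim : R[i] := qpoch Q (- Q) / qpoch Q Q.

Lemma qratio_lim_neq0 : qratio_lim != 0.
Proof. exact: mulf_neq0 qpoch_NQ_neq0 (invr_neq0 qpoch_Q_neq0). Qed.

Lemma qratio_cvg : ccvg (qratio q) qratio_lim.
Proof.
have h1 := @qpochn_cvg _ _ q_gt0 q_lt1 (- Q).
have h2 := ccvgV qpoch_Q_neq0 (@qpochn_cvg _ _ q_gt0 q_lt1 Q).
exact: ccvgM h1 h2.
Qed.

Definition polediff (a : R[i]) (j : int) : R[i] := pole a j - pole (-1) j.

Lemma polediffE a j : pole_free a ->
  polediff a j = (1 + a) * (Q ^ j * pole a j * pole (-1) j).
Proof.
move=> ra; have := ra j; have := pole_freeN1 q_gt0 j.
by rewrite /polediff /pole => h1 h2; field; rewrite h1 h2.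
Qed.

Lemma polediff_bound a : a != 0 -> pole_free a -> exists2 K : R, 0 <= K &
  forall j, normc (polediff a j) <= K * q ^+ `|j|.
Proof.
move=> a0 ra; have [K K0 KP] := expQ_pole_mul_bound q_gt0 q_lt1 a0 oneN_neq0 ra (pole_freeN1 q_gt0).
exists (normc (1 + a) * K); first by rewrite mulr_ge0 ?normc_ge0 ?ltW.
by move=> j; rewrite polediffE // normcM -[leRHS]mulrA ler_wpM2l ?normc_ge0.
Qed.

Lemma polediff_usums a : a != 0 -> pole_free a ->
  exists H, usums (fun j : int => (-1) ^ j * polediff a j) H.
Proof.
move=> a0 ra; have [K K0 KP] := polediff_bound a0 ra.
apply: (usums_ex (b := fun j : int => K * q ^+ `|j|)) => [j|].
  by rewrite normcM normc_sign mul1r.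
exact/bounded_sumsZ/(bounded_sums_geometric_int (ltW q_gt0) q_lt1).
Qed.

(** Let [N] tend to infinity in the finite expansion: for fixed [j] both [qratio]
    factors tend to the same limit, and since they are bounded uniformly the terms
    are dominated by a multiple of [q^|j|]. *)
Lemma theta_quotient_series a H : a != 0 -> pole_free a ->
  usums (fun j : int => (-1) ^ j * polediff a j) H ->
  qpoch Q (- a) * qpoch Q (- Q / a) / (qpoch Q a * qpoch Q (Q / a)) =
  qratio_lim ^+ 2 * (2 * H).
Proof.
move=> a0 ra aH.
have ran := pole_free_nat ra; have rqan := pole_free_nat (pole_free_Qdiv a0 ra).
have lhs : ccvg (fun N => E (- a) N.+1 * E (- Q / a) N / (E a N.+1 * E (Q / a) N))
    (qpoch Q (- a) * qpoch Q (- Q / a) / (qpoch Q a * qpoch Q (Q / a))).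
  have cv c := @qpochn_cvg _ _ q_gt0 q_lt1 c.
  have cvS c : ccvg (fun N => E c N.+1) (qpoch Q c).
    by apply: ccvg_comp (cv c) => M; exists M => n /leqW.
  have num := ccvgM (cvS (- a)) (cv (- Q / a)).
  have den := ccvgM (cvS a) (cv (Q / a)).
  have den0 : qpoch Q a * qpoch Q (Q / a) != 0 by rewrite mulf_neq0 // qpoch_neq0.
  exact: ccvgM num (ccvgV den0 den).
apply: (ccvg_unique lhs).
have [B B0 BP] := ccvg_bounded qratio_cvg.
have [K K0 KP] := polediff_bound a0 ra.
pose D (N : nat) : {fset int} := [fset j in [seq (i%:Z - N%:Z)%R | i <- iota 0 (N + N.+1)]]%fset.
pose F (N : nat) (j : int) : R[i] := if j \in D N then
  (-1) ^ j * (qratio q (absz (j + N%:Z)) * qratio q (absz (N%:Z - j))) * (2 * polediff a j) else 0.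
have DP N (j : int) : (j \in D N) = (`|j| <= N)%N.
  rewrite inE; apply/mapP/idP => [[k]|jN]; first by rewrite mem_iota => kN ->; lia.
  exists (absz (j + N%:Z)); last by lia.
  by rewrite mem_iota; lia.
have FE N : \sum_(j <- D N) F N j =
    E (- a) N.+1 * E (- Q / a) N / (E a N.+1 * E (Q / a) N).
  rewrite theta_quotient_partial_fractions //.
  transitivity (\sum_(j <- [seq (i%:Z - N%:Z)%R | i <- iota 0 (N + N.+1)]) F N j).
    apply: perm_big; apply: uniq_perm; first exact: fset_uniq.
      by rewrite map_inj_uniq ?iota_uniq // => i j /addIr [].
    by move=> j; rewrite inE.
  have -> : iota 0 (N + N.+1) = index_iota 0 (N + N.+1) by rewrite /index_iota subn0.
  rewrite big_map big_mkord; apply: eq_bigr => i _.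
  rewrite /F DP; have iN := ltn_ord i.
  have -> : (`|i%:Z - N%:Z| <= N)%N by lia.
  by congr (_ * (qratio q _ * qratio q _) * _); lia.
apply: (eq_ccvg FE).
have rhs : usums (fun j => (-1) ^ j * (qratio_lim * qratio_lim) * (2 * polediff a j))
   (qratio_lim ^+ 2 * (2 * H)).
  have := usumsZ (c := qratio_lim ^+ 2 * 2) aH; rewrite -mulrA; apply: eq_usums => j.
  ring.
apply: (usums_dominated (b := fun j : int => B * B * 2 * K * q ^+ `|j|)) rhs.
- apply/bounded_sumsZ/(bounded_sums_geometric_int (ltW q_gt0) q_lt1).
  by rewrite !mulr_ge0 // ltW.
- move=> N j; rewrite /F; case: ifP => _; last first.
    by rewrite normc0 !mulr_ge0 ?exprn_ge0 // ltW.
  have n2 : normc (2 : R[i]) = 2.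
    by rewrite -(rmorph_nat (real_complex R)) normc_real ger0_norm.
  rewrite (normcM (_ * _) (2 * _)) (normcM (_ ^ _)) (normcM (qratio _ _)) (normcM 2).
  rewrite normc_sign mul1r n2.
  rewrite [leRHS](_ : _ = B * B * (2 * (K * q ^+ `|j|))); last by ring.
  apply: ler_pM; rewrite ?mulr_ge0 ?normc_ge0 //.
    by apply: ler_pM; rewrite ?normc_ge0.
  by rewrite ler_pM2l.
- by move=> N j; rewrite /F => /negbTE->.
move=> j.
apply: (@eventually_eq_ccvg _ (fun N =>
   (-1) ^ j * (qratio q (absz (j + N%:Z)) * qratio q (absz (N%:Z - j))) * (2 * polediff a j))).
  by exists `|j|%N => N jN; rewrite /F DP jN.
have cv1 : ccvg (fun N => qratio q (absz (j + N%:Z))) qratio_lim.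
  by apply: (ccvg_comp _ qratio_cvg) => M; exists (M + `|j|)%N => n; lia.
have cv2 : ccvg (fun N => qratio q (absz (N%:Z - j))) qratio_lim.
  by apply: (ccvg_comp _ qratio_cvg) => M; exists (M + `|j|)%N => n; lia.
have csgn := ccvg_cst (c := (-1 : R[i]) ^ j).
exact: ccvgM (ccvgM csgn (ccvgM cv1 cv2)) (ccvg_cst (c := 2 * polediff a j)).
Qed.

End ThetaQuotientLimit.

(** * Alternating sums and even shifts *)

Section SignedSums.
Variable R : realType.

Lemma signD (j k : int) : (-1 : R[i]) ^ (j + k) = (-1) ^ j * (-1) ^ k.
Proof. by rewrite expfzDr // oneN_neq0. Qed.

Lemma signN (j : int) : (-1 : R[i]) ^ (- j) = (-1) ^ j.
Proof. by rewrite -exprz_inv invrN1. Qed.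

Lemma sign_even (n : int) : (-1 : R[i]) ^ (2 * n) = 1.
Proof.
have -> : 2 * n = n + n by ring.
by rewrite signD -[X in _ * X]signN -signD subrr.
Qed.

Lemma usums_shift (f : int -> R[i]) s (c : int) :
  usums f s -> usums (fun j => f (j + c)) s.
Proof.
apply: (usums_comp (h := fun j => j + c) (k := fun j => j - c)) => [j|j _]; ring.
Qed.

Lemma usums_reflect (f : int -> R[i]) s (c : int) :
  usums f s -> usums (fun j => f (c - j)) s.
Proof.
apply: (usums_comp (h := fun j => c - j) (k := fun j => c - j)) => [j|j _]; ring.
Qed.

(** Formally both halves of the sum agree after an even shift of [j], but neither
    half need converge.  Only the consecutive differences of [u] are summable;
    shifting their alternating sum by 1 and by 2 and subtracting settles the shift
    by 2, and the general case follows by iteration. *)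
Lemma usums_sign_shift (u : int -> R[i]) s (n : int) :
  usums (fun j : int => (-1) ^ j * (u j - u (j - 1))) s ->
  usums (fun j : int => (-1) ^ j * (u (j + 2 * n) - u j)) 0.
Proof.
move=> us.
have step : usums (fun j : int => (-1) ^ j * (u (j + 2) - u j)) 0.
  have := usumsB (usums_shift 2 us) (usums_shift 1 us); rewrite subrr.
  apply: eq_usums => j; rewrite /= !signD.
  rewrite !expr1z.
  rewrite addrK (_ : j + 2 - 1 = j + 1); [ring|ring].
have nonneg (m : nat) : usums (fun j : int => (-1) ^ j * (u (j + 2 * m%:Z) - u j)) 0.
  elim: m => [|m IH].
    have := usumsZ (c := 0) step; rewrite mulr0; apply: eq_usums => j.
    by rewrite mulr0 addr0 subrr !(mul0r, mulr0).
  have := usumsD IH (usums_shift (2 * m%:Z) step); rewrite addr0; apply: eq_usums => j.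
  rewrite signD sign_even (_ : j + 2 * m%:Z + 2 = j + 2 * m.+1%:Z); ring.
case: n => m; first exact: nonneg.
have := usumsZ (c := -1) (usums_shift (2 * Negz m) (nonneg m.+1)); rewrite mulr0.
apply: eq_usums => j; rewrite signD sign_even NegzE.
rewrite (_ : j + 2 * - m.+1%:Z + 2 * m.+1%:Z = j); ring.
Qed.

End SignedSums.

(** * The double sum along the lines j + k = m *)

Section Appell.
Variables (R : realType) (q : R).
Hypotheses (q_gt0 : 0 < q) (q_lt1 : q < 1).
Local Notation Q := (q%:C).
Local Notation pole_free := (pole_free q).
Local Notation pole := (pole q).

Let Q0 : Q != 0. Proof. exact: Q_neq0. Qed.

(** With [b = a / q], the difference is a constant times
    [q^j * pole a j * pole b j]. *)
Lemma pole_diff_usums a : a != 0 -> pole_free a ->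
  exists s, usums (fun j : int => (-1) ^ j * (pole a j - pole a (j - 1))) s.
Proof.
move=> a0 ra; pose b := a / Q.
have b0 : b != 0 by rewrite mulf_neq0 ?invr_eq0.
have bE (j : int) : b * Q ^ j = a * Q ^ (j - 1).
  by rewrite /b expfzDr // exprN1; ring.
have rb : pole_free b by move=> j; rewrite bE.
have [K K0 KP] := expQ_pole_mul_bound q_gt0 q_lt1 a0 b0 ra rb.
pose c := a * (1 - Q^-1).
apply: (usums_ex (b := fun j : int => normc c * K * q ^+ `|j|)) => [j|]; last first.
  apply/bounded_sumsZ/(bounded_sums_geometric_int (ltW q_gt0) q_lt1).
  by rewrite mulr_ge0 ?normc_ge0 ?ltW.
rewrite normcM normc_sign mul1r -mulrA.
have -> : pole a j - pole a (j - 1) = c * (Q ^ j * pole a j * pole b j).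
  rewrite /pole bE; have := ra j; have := ra (j - 1).
  rewrite /c expfzDr // exprN1 => h1 h2.
  have h3 : Q - a * Q ^ j != 0.
    have := mulf_neq0 Q0 h1.
    by rewrite mulrBr mulr1 (_ : Q * (a * (Q ^ j / Q)) = a * Q ^ j) //; field.
  by field; apply/and3P.
by rewrite normcM ler_wpM2l ?normc_ge0.
Qed.

(** The value does not depend on [n]: by the even-shift lemma [2 * n - j] may be
    replaced by [- j], and [pole (-1) j + pole (-1) (- j) = 1] turns the remaining
    summand into [polediff a j + polediff a (- j)]. *)
Lemma alternating_pole_sum a H (n : int) : a != 0 -> pole_free a ->
  usums (fun j : int => (-1) ^ j * polediff q a j) H ->
  usums (fun j : int => (-1) ^ j * (pole a j + pole a (2 * n - j) - 1)) (2 * H).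
Proof.
move=> a0 ra aH.
have [s /usums_sign_shift-/(_ n)/usums_reflect-/(_ 0) sh] := pole_diff_usums a0 ra.
have -> : 2 * H = H + H + 0 by ring.
apply: (eq_usums _ (usumsD (usumsD aH (usums_reflect 0 aH)) sh)) => j.
rewrite sub0r signN /polediff.
have -> : pole (-1) (- j) = 1 - pole (-1) j.
  rewrite /pole -invr_expz; have := pole_freeN1 q_gt0 j; have Qj : Q ^ j != 0 by rewrite expfz_neq0.
  rewrite mulN1r opprK => h; field.
  by rewrite h Qj.
rewrite (_ : - j + 2 * n = 2 * n - j); ring.
Qed.

Definition fiber_term (a : R[i]) (m j : int) : R[i] := (-1) ^ j * (pole a j * pole a (m - j)).

Lemma fiber_term_bound a : a != 0 -> pole_free a -> exists2 K : R, 0 < K &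
  forall m j, normc (fiber_term a m j) <= K * (q ^+ `|m|)^-1 * q ^+ `|j|.
Proof.
move=> a0 ra; have [K K0 KP] := pole_mul_reflect_bound q_gt0 q_lt1 a0 a0 ra ra.
by exists K => // m j; rewrite normcM normc_sign mul1r.
Qed.

(** With [X = a q^j] and [Y = a q^(2n-j)], whose product [a^2 q^2n] is independent
    of [j], this is the identity
    [(1 - X Y) / ((1 - X) (1 - Y)) = 1 / (1 - X) + 1 / (1 - Y) - 1]. *)
Lemma fiber_sum_even a H (n : int) : a != 0 -> pole_free a -> pole_free (- a) ->
  usums (fun j : int => (-1) ^ j * polediff q a j) H ->
  usums (fiber_term a (2 * n)) (2 * H / (1 - a ^+ 2 * Q ^ (2 * n))).
Proof.
move=> a0 ra rNa aH.
rewrite [2 * H / _]mulrC.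
apply: (eq_usums _ (usumsZ (alternating_pole_sum n a0 ra aH))) => j.
have h : 1 - a ^+ 2 * Q ^ (2 * n) != 0.
  have := mulf_neq0 (ra n) (rNa n); rewrite mulNr opprK => h; apply: contra_neq h => h.
  by rewrite -[RHS]h (_ : 2 * n = n + n) ?expfzDr //; ring.
have E : a ^+ 2 * Q ^ (2 * n) = (a * Q ^ j) * (a * Q ^ (2 * n - j)).
  by rewrite mulrACA -expfzDr // (_ : j + (2 * n - j) = 2 * n) //; ring.
rewrite /fiber_term /pole; have := ra j; have := ra (2 * n - j).
move: h; rewrite E; move: (a * Q ^ j) (a * Q ^ (2 * n - j)) => X Y h1 h2 h3.
by field; rewrite h1 h2 h3.
Qed.

(** The reflection [j -> 2n+1-j] changes the sign of every term. *)
Lemma fiber_sum_odd a (n : int) : a != 0 -> pole_free a ->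
  usums (fiber_term a (2 * n + 1)) 0.
Proof.
move=> a0 ra; have [K K0 KP] := fiber_term_bound a0 ra.
have [s sP] : exists s, usums (fiber_term a (2 * n + 1)) s.
  apply: (usums_ex (b := fun j : int => K * (q ^+ `|2 * n + 1|)^-1 * q ^+ `|j|)) => [j|].
    exact: KP.
  apply/bounded_sumsZ/(bounded_sums_geometric_int (ltW q_gt0) q_lt1).
  by rewrite mulr_ge0 ?invr_ge0 ?exprn_ge0 ?ltW.
have : usums (fiber_term a (2 * n + 1)) (-1 * s).
  have := usumsZ (c := -1) (usums_reflect (2 * n + 1) sP); apply: eq_usums => j.
  rewrite /fiber_term !signD sign_even signN expr1z.
  rewrite (_ : 2 * n + 1 - (2 * n + 1 - j) = j); ring.
move=> /(usums_unique sP) ss; suff s0 : s = 0 by move: sP; rewrite s0.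
have : 2 * s = 0 by rewrite mulr_natl mulr2n {1}ss; ring.
by move/eqP; rewrite mulf_eq0 pnatr_eq0 => /eqP.
Qed.

(** The double sum is regrouped along [j + k = m].  Lines with [m] odd
    contribute nothing; the line [m = 2n] contributes a constant times the [n]th
    term of the single sum, and that constant is the theta quotient. *)
Lemma appell_identity x a :
  x != 0 -> a != 0 -> pole_free a -> pole_free (- a) ->
  let f := fun n : int =>
    Q ^ (4 * n ^+ 2) * x ^ (2 * n) / (1 - a ^+ 2 * Q ^ (2 * n)) in
  let g := fun jk : int * int => let: (j, k) := jk in
    Q ^ ((j + k) ^+ 2) * (-1) ^ j * x ^ (j + k)
      / ((1 - a * Q ^ j) * (1 - a * Q ^ k)) in
  [/\ usummable f, usummable g
    & qpoch Q (- a) * qpoch Q (- Q / a) / (qpoch Q a * qpoch Q (Q / a))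
       / qratio_lim q ^+ 2 * usum f = usum g].
Proof.
move=> x0 a0 ra rNa f g.
have [H aH] := polediff_usums q_gt0 q_lt1 a0 ra.
have theta : qpoch Q (- a) * qpoch Q (- Q / a) / (qpoch Q a * qpoch Q (Q / a))
    / qratio_lim q ^+ 2 = 2 * H.
  rewrite (theta_quotient_series q_gt0 q_lt1 a0 ra aH) mulrC mulKf //.
  exact: expf_neq0 (qratio_lim_neq0 q_gt0 q_lt1).
pose X := normc x; have X0 : 0 < X by rewrite normc_gt0.
pose W (m : int) : R := q ^ (m ^+ 2) * X ^ m * (q ^+ `|m|)^-1.
have W0 m : 0 <= W m by rewrite !mulr_ge0 ?invr_ge0 ?exprn_ge0 ?exprz_ge0 ?ltW.
have bW : bounded_sums W := bounded_sums_theta q_gt0 q_lt1 X0.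
pose w (m : int) : R[i] := Q ^ (m ^+ 2) * x ^ m.
have wW m : normc (w m) * (q ^+ `|m|)^-1 = W m.
  by rewrite /w normcM !normcXz normc_real gtr0_norm.
have [K K0 KP] := fiber_term_bound a0 ra.
pose G (p : int * int) := w p.1 * fiber_term a p.1 p.2.
have [s Gs] : exists s, usums G s.
  apply: (usums_ex (b := fun p : int * int => (K * W p.1) * q ^+ `|p.2|)) => [[m j]|].
    rewrite /G normcM /= -wW; apply: le_trans (ler_wpM2l (normc_ge0 _) (KP m j)) _.
    by rewrite le_eqVlt; apply/orP/or_introl/eqP; ring.
  apply: (@bounded_sums_prod _ _ _ (fun m => K * W m) (fun j : int => q ^+ `|j|)) => [m|j||].
  - by rewrite mulr_ge0 // ltW.
  - by rewrite exprn_ge0 // ltW.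
  - by apply: bounded_sumsZ bW; rewrite ltW.
  - exact: bounded_sums_geometric_int (ltW q_gt0) q_lt1.
have gs : usums g s.
  have := usums_comp (h := fun p : int * int => (p.1 + p.2, p.1))
    (k := fun p => (p.2, p.1 - p.2)) _ _ Gs.
  move=> /(_ _ _)/eq_usums; apply.
  - move=> [j k] /=; rewrite /G /g /w /fiber_term /pole /=.
    by rewrite (_ : j + k - j = k) ?invfM; ring.
  - by move=> [j k] /=; congr (_, _); ring.
  - by move=> [m j] _ /=; congr (_, _); ring.
pose S (m : int) := if (2 %| m)%Z then w m * (2 * H / (1 - a ^+ 2 * Q ^ m)) else 0.
have fib m : usums (fun j => G (m, j)) (S m).
  rewrite /S; case: ifP => m2.
    by rewrite -(divzK m2) mulrC; apply: usumsZ; exact: fiber_sum_even.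
  have -> : m = 2 * (m %/ 2)%Z + 1.
    by move: m2; lia.
  by rewrite -(mulr0 (w (2 * (m %/ 2)%Z + 1))); apply: usumsZ; exact: fiber_sum_odd.
have Ss := usums_fiber Gs fib.
have S2 : usums (fun n : int => S (2 * n)) s.
  apply: (usums_comp (h := fun n : int => 2 * n) (k := fun m => (m %/ 2)%Z)) Ss => [n|m].
    by rewrite mulKz.
  rewrite /S; case: ifP => [m2 _|_]; last by rewrite eqxx.
  by rewrite mulrC divzK.
have S2E n : S (2 * n) = 2 * H * f n.
  rewrite /S dvdz_mulr // /w /f (_ : (2 * n) ^+ 2 = 4 * n ^+ 2); ring.
have [L L0 LP] := pole_bound q_gt0 q_lt1 a0 ra.
have Na0 : - a != 0 by rewrite oppr_eq0.
have [M M0 MP] := pole_bound q_gt0 q_lt1 Na0 rNa.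
have [t ft] : exists t, usums f t.
  apply: (usums_ex (b := fun n => L * M * W (2 * n))) => [n|]; last first.
    apply: bounded_sumsZ; first by rewrite mulr_ge0 // ltW.
    exact: bounded_sums_comp (@mulfI _ (2 : int) isT) bW.
  have -> : f n = pole a n * pole (- a) n * w (2 * n).
    rewrite /f /w /pole (_ : (2 * n) ^+ 2 = 4 * n ^+ 2); last by ring.
    rewrite mulrC; congr (_ * _); rewrite -invfM; congr (_^-1).
    by rewrite (_ : 2 * n = n + n) ?expfzDr //; ring.
  rewrite (normcM (pole a n * _) (w _)) (normcM (pole a n)) -wW.
  apply: ler_pM; rewrite ?mulr_ge0 ?normc_ge0 //.
    by apply: ler_pM; rewrite ?normc_ge0 //; [exact: (LP n).1 | exact: (MP n).1].
  by rewrite ler_peMr ?normc_ge0 // invf_ge1 ?exprn_gt0 // exprn_ile1 // ltW.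
split; [exact: usums_summable ft | exact: usums_summable gs |].
rewrite theta (usumE ft) (usumE gs); apply: usums_unique S2.
by apply: eq_usums (usumsZ (c := 2 * H) ft) => n; rewrite S2E.
Qed.

End Appell.

(** * Admissible parameters *)

Section Specialization.
Variables (R : realType) (q : R).
Hypotheses (q_gt0 : 0 < q) (q_lt1 : q < 1).
Local Notation Q := (q%:C).

Lemma pole_free_of_neq a : (forall k : int, a != Q ^ k) -> pole_free q a.
Proof.
move=> aQ k; rewrite subr_eq0; apply: contra (aQ (- k)) => /eqP h.
by rewrite -invr_expz -[X in X == _](mulfK (expfz_neq0 k (Q_neq0 q_gt0))) -h mul1r.
Qed.

(** The half-integral powers of the second identity are the integral ones for the
    parameter [a = - i q^(1/2)]. *)
Lemma half_shift (j : int) :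
  'i * (q `^ (j%:~R + 2^-1))%:C = - (- 'i * (q `^ 2^-1)%:C * Q ^ j) :> R[i].
Proof.
rewrite powRD; last by apply/implyP => _; rewrite gt_eqF.
by rewrite powR_intmul ?ltW // rmorphM /= -expQ_real //; ring.
Qed.

(** If [a q^k = 1] then [q^(2k+1) = - (a q^k)^2 = -1], but [q^(2k+1)] is
    positive. *)
Lemma pole_free_of_sqr a : a ^+ 2 = - Q -> pole_free q a.
Proof.
move=> a2 k; have := pole_freeN1 q_gt0 (2 * k + 1); apply: contra_neq => /eqP.
rewrite subr_eq0 => /eqP h.
have -> : Q ^ (2 * k + 1) = Q * (Q ^ k * Q ^ k).
  by rewrite -!expfzDr ?Q_neq0 // -{2}(expr1z Q) -expfzDr ?Q_neq0 //; congr (_ ^ _); ring.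
have -> : -1 * (Q * (Q ^ k * Q ^ k)) = (a * Q ^ k) ^+ 2.
  by rewrite mulrA mulN1r -a2; ring.
by rewrite -h expr1n subrr.
Qed.

End Specialization.

Theorem corollary4p4 (R : realType) (q : R) (x : R[i])
    (q_gt0 : 0 < q) (q_lt1 : q < 1) (x_neq0 : x != 0) :
  (forall a : R[i], a != 0 ->
    (forall k : int, a != q%:C ^ k /\ a != - q%:C ^ k) ->
    let f := fun n : int =>
      q%:C ^ (4 * n ^+ 2) * x ^ (2 * n) / (1 - a ^+ 2 * q%:C ^ (2 * n)) in
    let g := fun jk : int * int => let: (j, k) := jk in
      q%:C ^ ((j + k) ^+ 2) * (-1) ^ j * x ^ (j + k)
        / ((1 - a * q%:C ^ j) * (1 - a * q%:C ^ k)) in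
    [/\ usummable f, usummable g
      & qpochs q%:C [:: - a; - q%:C / a; q%:C; q%:C]
          / qpochs q%:C [:: a; q%:C / a; - q%:C; - q%:C] * usum f = usum g])
  /\
  (let f := fun n : int =>
     q%:C ^ (4 * n ^+ 2) * x ^ (2 * n) / (1 + q%:C ^ (2 * n + 1)) in
   let g := fun jk : int * int => let: (j, k) := jk in
     q%:C ^ ((j + k) ^+ 2) * (-1) ^ j * x ^ (j + k)
       / ((1 + 'i * (q `^ (j%:~R + 2^-1))%:C)
          * (1 + 'i * (q `^ (k%:~R + 2^-1))%:C)) in
   [/\ usummable f, usummable g
     & qpochs q%:C [:: q%:C; q%:C] / qpochs q%:C [:: - q%:C; - q%:C] * usum f
       = usum g]).
Proof.
split=> [a a0 aQ|f g].
  have ra : pole_free q a by apply: pole_free_of_neq => // k; case: (aQ k).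
  have rNa : pole_free q (- a).
    by apply: pole_free_of_neq => // k; rewrite eqr_oppLR; case: (aQ k).
  have [fs gs E] := appell_identity q_gt0 q_lt1 x_neq0 a0 ra rNa.
  split=> //; rewrite -E; congr (_ * _).
  rewrite /qpochs !big_cons !big_nil !mulr1 /qratio_lim.
  by rewrite -exprVn invf_div !invfM; ring.
pose a : R[i] := - 'i * (q `^ 2^-1)%:C.
have sqr_half : (q `^ 2^-1)%:C ^+ 2 = q%:C :> R[i].
  by rewrite -rmorphXn /= -powR_mulrn ?powR_ge0 // -powRrM mulVf ?powRr1 ?ltW.
have a2 : a ^+ 2 = - q%:C by rewrite exprMn sqrrN sqr_i sqr_half mulN1r.
have a0 : a != 0 by rewrite -sqrf_eq0 a2 oppr_eq0 Q_neq0.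
have ra := pole_free_of_sqr q_gt0 a2.
have rNa : pole_free q (- a) by apply: pole_free_of_sqr => //; rewrite sqrrN.
have [fs gs E] := appell_identity q_gt0 q_lt1 x_neq0 a0 ra rNa.
have -> : f = (fun n : int =>
    q%:C ^ (4 * n ^+ 2) * x ^ (2 * n) / (1 - a ^+ 2 * q%:C ^ (2 * n))).
  apply/funext => n; rewrite /f a2 mulNr opprK.
  by rewrite [2 * n + 1]addrC expfzDr ?Q_neq0 // expr1z.
have -> : g = (fun jk : int * int => let: (j, k) := jk in
    q%:C ^ ((j + k) ^+ 2) * (-1) ^ j * x ^ (j + k)
      / ((1 - a * q%:C ^ j) * (1 - a * q%:C ^ k))).
  by apply/funext => -[j k]; rewrite /g !half_shift.
split=> //; rewrite -E; congr (_ * _).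
(* Since a ^ 2 = - q, the theta quotient is invariant under a -> -q / a and
   collapses to 1. *)
have divaE : - q%:C / a = a by rewrite -a2 expr2 mulfK.
have divNaE : q%:C / a = - a by rewrite -[in RHS]divaE mulNr opprK.
rewrite divaE divNaE [X in X / _ / _]mulrC divff ?mul1r; last first.
  by apply: mulf_neq0; apply: qpoch_neq0 => //; apply: pole_free_nat.
by rewrite /qpochs !big_cons !big_nil !mulr1 /qratio_lim -exprVn invf_div !invfM; ring.
Qed.
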